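(* Let $p$ be a prime, $n\ge 1$, $q=p^n$. For a polynomial $P\in\mathbb{F}_q[x]$ of degree $d$, let $P_0(x)=P(x)-P(0)$ and write the bivariate polynomial $$P_0(x+y)-P_0(x)-P_0(y)=\sum_{i=1}^{d-1}F_i(y)x^i,\qquad F_i\in\mathbb{F}_q[y].$$ Let $V$ be the set of all $y\in\mathbb{F}_q$ such that $P_0(x+y)-P_0(x)-P_0(y)=0$ in $\mathbb{F}_q[x]$, and let $\mathcal{L}(x)=\prod_{v\in V}(x-v)$. Then $$\mathcal{L}(x)=\gcd(F_1(x),\ldots,F_{d-1}(x),x^q-x).$$
   Context: The gcd is taken to be monic. *)

(* Defs.v *)
From mathcomp Require Import all_boot all_algebra.

Set Implicit Arguments.
Unset Strict Implicit.
Unset Printing Implicit Defensive.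

Import GRing.Theory.
Local Open Scope ring_scope.

Section AdditivityDefect.
Variable F : finFieldType.
Implicit Type P : {poly F}.

Definition poly_no_const P : {poly F} := P - P.[0]%:P.

(* P_0(x + y) - P_0(x) - P_0(y) in {poly {poly F}} = F[y][x]: the outer 'X is
   x, and y is the constant 'X%:P, so that the coefficient of x^i is a
   polynomial in y. *)
Definition defect2 P : {poly {poly F}} :=
  let P0 := poly_no_const P in
  P0^:P \Po ('X + 'X%:P) - P0^:P - P0%:P.

Definition defect_at P (v : F) : {poly F} :=
  let P0 := poly_no_const P in
  P0 \Po ('X + v%:P) - P0 - P0.[v]%:P.

Definition additive_shifts P : {set F} := [set v | defect_at P v == 0].

Definition shifts_poly P : {poly F} :=
  \prod_(v in additive_shifts P) ('X - v%:P).

(* gcdp is only determined up to a nonzero scalar, hence the normalization;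
   the value is 0 when every polynomial of s is 0. *)
Definition monic_gcd (s : seq {poly F}) : {poly F} :=
  let g := \big[@gcdp F/0]_(f <- s) f in (lead_coef g)^-1 *: g.

Lemma dvdp_monic_gcd (s : seq {poly F}) (g : {poly F}) :
  (g %| monic_gcd s) = all (fun f => g %| f) s.
Proof.
rewrite /monic_gcd; set h := \big[_/_]_(_ <- _) _.
have -> : (g %| (lead_coef h)^-1 *: h) = (g %| h).
  have [->|h0] := eqVneq h 0; first by rewrite scaler0.
  by rewrite dvdpZr // invr_eq0 lead_coef_eq0.
rewrite {}/h; elim: s => [|f s IHs]; first by rewrite big_nil dvdp0.
by rewrite big_cons dvdp_gcd IHs.
Qed.

Lemma monic_gcd_monic (s : seq {poly F}) (f : {poly F}) :
  f \in s -> f != 0 -> monic_gcd s \is monic.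
Proof.
move=> fs f0; have : monic_gcd s %| f.
  by have := dvdp_monic_gcd s (monic_gcd s); rewrite dvdpp => /esym/allP; apply.
rewrite /monic_gcd; set h := \big[_/_]_(_ <- _) _ => hf.
have h0 : h != 0.
  by apply: contraNneq f0 => h0; move: hf; rewrite h0 scaler0 dvd0p.
by rewrite monicE lead_coefZ mulVf // lead_coef_eq0.
Qed.

Lemma defect2_expansion (d : nat) P : size P = d.+1 ->
  exists Fc : nat -> {poly F},
    defect2 P = \sum_(1 <= i < d) (Fc i)%:P * 'X^i.
Proof.
move=> sP; exists (fun i => (defect2 P)`_i).
have sP0 : (size (poly_no_const P) <= d.+1)%N.
  rewrite (leq_trans (size_polyD _ _)) // geq_max sP leqnn size_polyN.
  by rewrite (leq_trans (size_polyC_leq1 _)).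
set P0 := poly_no_const P in sP0.
have e0 : (defect2 P)`_0 = 0.
  rewrite -horner_coef0 /defect2 -/P0 !hornerE horner_comp !hornerE.
  have -> : P0^:P.['X] = P0.
    by have := comp_polyXr P0; rewrite /comp_poly.
  have -> : P0^:P.[0] = 0.
    rewrite -(polyC0 F) horner_map /= /P0 /poly_no_const hornerD hornerN.
    by rewrite hornerC subrr polyC0.
  by rewrite subr0 subrr.
have sP0P : size P0^:P = size P0 by exact: size_map_polyC.
have lc : size (P0^:P \Po ('X + 'X%:P)) = size P0.
  by rewrite size_comp_poly2 // size_XaddC.
have sD : (size (defect2 P) <= maxn 1 d)%N.
  apply/leq_sizeP => j dj; rewrite /defect2 -/P0 !coefB coefC.
  have -> : (j == 0)%N = false by move: dj; case: j => //; rewrite geq_max ltn0.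
  have {}dj : (d <= j)%N by move: dj; rewrite geq_max => /andP[].
  rewrite subr0; have [dj'|jd] := ltnP d j.
    rewrite !nth_default ?subr0 ?lc ?sP0P //; exact: leq_trans sP0 dj'.
  have -> : j = d by apply/eqP; rewrite eqn_leq jd dj.
  have [sd|sd] := leqP (size P0) d; first by rewrite !nth_default ?subr0 ?lc ?sP0P.
  have {}sd : size P0 = d.+1 by apply/eqP; rewrite eqn_leq sP0 sd.
  have := lead_coef_comp P0^:P (q := 'X + 'X%:P).
  rewrite size_XaddC => /(_ isT).
  by rewrite lead_coefXaddC expr1n mulr1 !lead_coefE lc sP0P sd /= => ->; rewrite subrr.
apply/polyP => j; rewrite coef_sum.
under eq_bigr do rewrite coefCM coefXn.
have [/andP[j1 jd]|] := boolP ((0 < j) && (j < d))%N.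
  rewrite (bigD1_seq j) ?mem_index_iota ?j1 ?iota_uniq //= eqxx mulr1.
  by rewrite big1 ?addr0 // => i /negPf; rewrite eq_sym => ->; rewrite mulr0.
move=> j1d; rewrite big_nat big1 => [|i hi]; last first.
  by case: eqP => [ji|_]; [rewrite ji hi in j1d | rewrite mulr0].
case: j j1d => [|j] // /=; rewrite -leqNgt => dj.
by rewrite nth_default // (leq_trans sD) // geq_max dj.
Qed.

End AdditivityDefect.

(* Main.v *)
Require Import Defs.
From mathcomp Require Import all_boot all_algebra finfield.
Import GRing.Theory.
Local Open Scope ring_scope.

(** Specializing y to v turns the bivariate defect into the defect at v, so its
    coefficients in x become the values F_i(v): hence v lies in V exactly when
    v is a common root of the F_i ([additive_shifts_roots]).  Every element of
    the field F is a root of X^q - X, so V is also the set of roots in F of the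
    gcd g.  Now X^q - X is the product of the X - v over all v in F; a monic
    divisor of it, such as g, is therefore the product of the X - v over its
    own roots ([monic_dvd_genPoly_prod_roots]), which is the product over V. *)

Lemma poly_defect_at (F : finFieldType) (P : {poly F}) (v : F) :
  map_poly (horner_eval v) (defect2 P) = defect_at P v.
Proof.
have evC (Q : {poly F}) : map_poly (horner_eval v) Q^:P = Q.
  by rewrite -map_poly_comp map_poly_id // => c _; rewrite /= /horner_eval hornerC.
rewrite /defect2 /defect_at; move: (poly_no_const P) => P0.
rewrite !rmorphB /= map_comp_poly /= !evC rmorphD /=.
by rewrite map_polyX !map_polyC /= /horner_eval hornerX.
Qed.

Lemma additive_shifts_roots (F : finFieldType) (P : {poly F}) (d : nat)
    (Fc : nat -> {poly F}) (v : F) :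
  defect2 P = \sum_(1 <= i < d) (Fc i)%:P * 'X^i ->
  (v \in additive_shifts P) = all (fun i => root (Fc i) v) (index_iota 1 d).
Proof.
move=> Fc_def; rewrite inE -poly_defect_at Fc_def rmorph_sum /=.
under eq_bigr do rewrite rmorphM /= map_polyC map_polyXn /= /horner_eval.
apply/eqP/allP => [sum0 i i_in | root_v]; last first.
  by rewrite big_seq big1 // => i /root_v /rootP ->; rewrite mul0r.
apply/rootP; move/(congr1 (fun Q : {poly F} => Q`_i)): sum0.
rewrite coef0 coef_sum (bigD1_seq i) ?iota_uniq //= coefCM coefXn eqxx mulr1.
rewrite big1 ?addr0 // => j /negPf ji.
by rewrite coefCM coefXn eq_sym ji mulr0.
Qed.

(** The polynomial X^#|F| - X splits over F with simple roots, and so do all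
    its divisors: a monic one is determined by its set of roots in F. *)
Lemma monic_dvd_genPoly_prod_roots (F : finFieldType) (g : {poly F}) :
  g \is monic -> g %| 'X^#|F| - 'X -> g = \prod_(v | root g v) ('X - v%:P).
Proof.
move=> g_monic; rewrite finField_genPoly => /dvdp_prod_XsubC [m].
rewrite eqp_monic ?monic_prod_XsubC // => /eqP g_eq.
rewrite {1}g_eq big_uniq ?mask_uniq ?index_enum_uniq //=.
by apply: eq_bigl => v; rewrite g_eq root_prod_XsubC.
Qed.

Theorem corollary3p4 (p n q : nat) (p_prime : prime p) (n_gt0 : (0 < n)%N)
    (q_def : q = (p ^ n)%N) (F : finFieldType) (cardF : #|F| = q)
    (P : {poly F}) (d : nat) (degP : size P = d.+1)
    (Fc : nat -> {poly F})
    (Fc_def : defect2 P = \sum_(1 <= i < d) (Fc i)%:P * 'X^i) :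
  shifts_poly P =
    monic_gcd (rcons [seq Fc i | i <- index_iota 1 d] ('X^q - 'X)).
Proof.
rewrite -cardF; set s := rcons _ _.
have Xq_in : 'X^#|F| - 'X \in s by rewrite mem_rcons mem_head.
have Xq_neq0 : 'X^#|F| - 'X != 0 :> {poly F}.
  by rewrite finField_genPoly monic_neq0 // monic_prod_XsubC.
have g_dvd : monic_gcd s %| 'X^#|F| - 'X.
  have := dvdp_monic_gcd s (monic_gcd s); rewrite dvdpp => /esym /allP.
  exact.
rewrite (monic_dvd_genPoly_prod_roots _ _ (monic_gcd_monic Xq_in Xq_neq0) g_dvd).
apply: eq_bigl => v; rewrite (additive_shifts_roots _ _ _ _ _ Fc_def).
rewrite -dvdp_XsubCl dvdp_monic_gcd all_rcons all_map.
have -> : 'X - v%:P %| 'X^#|F| - 'X.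
  by rewrite dvdp_XsubCl; apply/rootP; rewrite !hornerE expf_card subrr.
by apply: eq_all => i; rewrite /= dvdp_XsubCl.
Qed.
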